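(* There is an absolute constant $C>0$ such that the following holds. Let $\Gamma$ be a finite Abelian group with $|\Gamma|=n$, let $S$ be a symmetric multiset of elements of $\Gamma$ with $|S| = d$, let $G = \mathrm{Cay}(\Gamma,S)$, and let $0<\epsilon\le 1$. Then $\mathrm{CD}_\epsilon(G) \le \mathrm{mul}_\tau(G)$ for $\tau = C\, d\, \phi(G)^2/\epsilon^2$.
   Context: A multiset $S$ of elements of $\Gamma$ is symmetric if $x$ and $-x$ have equal multiplicity for all $x$. $\mathrm{Cay}(\Gamma,S)$ has vertex set $\Gamma$ and an edge $(v,v+s)$ for every $v$ and every element $s$ of $S$ (with multiplicity). For $Q\subseteq\Gamma$, $\partial Q$ is the multiset of edges $(i,j)$ with $i\in Q$, $j\notin Q$. Conductance: $\phi_G(Q)=|\partial Q|/(d|Q|)$ and $\phi(G)=\min\{\phi_G(Q): 1\le|Q|\le n/2\}$. Sparsity: $\psi_G(Q)=|\partial Q|/(|Q|(n-|Q|))$ for $\emptyset\ne Q\subsetneq\Gamma$, $\psi(G)=\min_Q\psi_G(Q)$. Normalized Laplacian $\mathbf{L}=I-\mathbf{A}$ ($\mathbf{A}$ the normalized adjacency matrix), with a fixed orthonormal eigenbasis $v_1,\dots,v_n$ and eigenvalues $\lambda_1\le\dots\le\lambda_n$; $\mathrm{mul}_\tau(G)=|\{i:\lambda_i\le\tau\}|$ (equal to $n$ if $\tau\ge 2$). For $x\in\mathbb{R}^n$, $\bar x=x-\frac{\langle x,\mathbf 1\rangle}{n}\mathbf 1$; $\mathbf{1}_Q$ is the indicator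 vector of $Q$. For a subspace $W$, $C_\epsilon(W)=\{x:\|x\|=1,\|\Pi_Wx\|^2\ge1-\epsilon\}$. $\mathrm{CD}_\epsilon(G)$ is the smallest $k$ such that some $\emptyset\ne Q\subsetneq\Gamma$ has $\psi_G(Q)\le\psi(G)$ (i.e., $Q$ is a sparsest cut) and $\bar{\mathbf 1}_Q/\|\bar{\mathbf 1}_Q\|\in C_\epsilon(\mathrm{span}(v_1,\dots,v_k))$. *)

(* Defs.v *)
From HB Require Import structures.
From mathcomp Require Import all_boot all_order all_algebra.
From mathcomp Require Import reals Rstruct.
From Stdlib Require Rdefinitions.
Set Implicit Arguments. Unset Strict Implicit. Unset Printing Implicit Defensive.
Import Order.TTheory GRing.Theory Num.Theory.
Local Open Scope ring_scope.

Section CayleyDefs.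
Variables (Gamma : finZmodType) (S : seq Gamma).

Definition ngr : nat := #|{: Gamma}|.
Definition deg : nat := size S.

Definition symmetric_mset : Prop :=
  forall x : Gamma, count_mem x S = count_mem (- x) S.

Definition bdry (Q : {set Gamma}) : nat :=
  \sum_(x in Q) count (fun s => (x + s)%R \notin Q) S.

Definition cond (Q : {set Gamma}) : Rdefinitions.R :=
  (bdry Q)%:R / (deg%:R * (#|Q|)%:R).

(* phi(G) = min { phi_G(Q) : 1 <= |Q| <= n/2 }.  The fold starts at 1, which
   is harmless since phi_G(Q) <= 1 for every Q (|dQ| <= d|Q|) and the index
   set is nonempty when n >= 2. *)
Definition conductance : Rdefinitions.R :=
  \big[Num.min/1]_(Q : {set Gamma} | (0 < #|Q|)%N && (#|Q|.*2 <= ngr)%N) cond Q.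

Definition spars (Q : {set Gamma}) : Rdefinitions.R :=
  (bdry Q)%:R / ((#|Q|)%:R * (ngr - #|Q|)%:R).

Definition proper_cut (Q : {set Gamma}) : bool := (Q != set0) && (Q != setT).

Definition sparsest_cut (Q : {set Gamma}) : bool :=
  proper_cut Q && [forall Q' : {set Gamma}, proper_cut Q' ==> (spars Q <= spars Q')].

Definition dotv (x y : Gamma -> Rdefinitions.R) : Rdefinitions.R := \sum_(g : Gamma) x g * y g.
Definition normv (x : Gamma -> Rdefinitions.R) : Rdefinitions.R := Num.sqrt (dotv x x).

Definition nlap (f : Gamma -> Rdefinitions.R) : Gamma -> Rdefinitions.R :=
  fun u => f u - (deg%:R)^-1 * \sum_(s <- S) f (u + s)%R.

Definition indic (Q : {set Gamma}) : Gamma -> Rdefinitions.R := fun g => (g \in Q)%:R.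
Definition center (x : Gamma -> Rdefinitions.R) : Gamma -> Rdefinitions.R :=
  fun g => x g - dotv x (fun _ => 1) / (ngr%:R).

Variables (lam : 'I_ngr -> Rdefinitions.R) (v : 'I_ngr -> Gamma -> Rdefinitions.R).

Definition orthonormal_basis : Prop :=
  forall i j : 'I_ngr, dotv (v i) (v j) = (i == j)%:R.
Definition eigen_pairs : Prop :=
  forall (i : 'I_ngr) (g : Gamma), nlap (v i) g = lam i * v i g.
Definition sorted_eigenvalues : Prop :=
  forall i j : 'I_ngr, (i <= j)%N -> lam i <= lam j.

Definition mul_tau (tau : Rdefinitions.R) : nat := #|[set i : 'I_ngr | lam i <= tau]|.

(* orthogonal projection onto W_k = span(v_1,...,v_k) (v orthonormal) *)
Definition projW (k : nat) (x : Gamma -> Rdefinitions.R) : Gamma -> Rdefinitions.R :=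
  fun g => \sum_(i : 'I_ngr | (i < k)%N) dotv x (v i) * v i g.

Definition in_Ceps (eps : Rdefinitions.R) (k : nat) (x : Gamma -> Rdefinitions.R) : bool :=
  (normv x == 1) && (1 - eps <= normv (projW k x) ^+ 2).

Definition normalize (x : Gamma -> Rdefinitions.R) : Gamma -> Rdefinitions.R := fun g => x g / normv x.

Definition CD_ok (eps : Rdefinitions.R) (k : nat) : bool :=
  [exists Q : {set Gamma},
     sparsest_cut Q && in_Ceps eps k (normalize (center (indic Q)))].

(* CD_eps(G) = smallest k with CD_ok k (searched in 0..n; k = n always works) *)
Definition CD (eps : Rdefinitions.R) : nat := find (CD_ok eps) (iota 0 ngr.+1).

End CayleyDefs.

(* Main.v *)
(** The idea is a Buser-type argument.  Let [f] be the centered indicator of a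
    sparsest cut [Q] and [W = I - L/2] the lazy walk.  If [k] is about [2 / tau],
    then [<f, (I - W^k) f>] is at least half of the mass of [f] on the
    eigenvectors with eigenvalue above [tau].  On the other hand this quantity is
    the expected number of [x \in Q] that leave [Q] when translated by the
    position [Y] of the lazy walk after [k] steps.  As the group is Abelian,
    [Y = \sum_i c_i s_i], where [c] is a lazy walk on [Z^d] whose coordinates have
    variance [k / (2 d)], and a translation by [Y] makes at most
    [\sum_i |c_i| |\partial_{s_i} Q|] points leave [Q].  So the quantity is at most
    of order [sqrt (k / d) |\partial Q|], and for a sparsest cut
    [|\partial Q| <= 2 d phi(G) |f|^2]. *)

Require Import Defs.
From HB Require Import structures.
From mathcomp Require Import all_boot all_order all_algebra.
From mathcomp Require Import reals Rstruct boolp.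
From mathcomp Require Import ring lra zify.
From Stdlib Require Rdefinitions.
Import Order.TTheory GRing.Theory Num.Theory.
Local Open Scope ring_scope.
Set Implicit Arguments. Unset Strict Implicit. Unset Printing Implicit Defensive.

Local Notation R := Rdefinitions.R.

(** * Lazy walks *)

Section LazyWalk.
Context {A : zmodType}.
Implicit Types (e : seq A) (h : A -> R) (x : A).

(* Steps are taken in both directions, so that a list of generators of [Z^d] can
   be used without its opposites. *)
Definition lazy_walk e h x : R :=
  (\sum_(s <- e) (h x *+ 2 + h (x + s) + h (x - s))) / (size e)%:R / 4.

Lemma lazy_walk_le {e} {h1 h2 : A -> R} :
  (forall x, h1 x <= h2 x) -> forall x, lazy_walk e h1 x <= lazy_walk e h2 x.
Proof.
move=> le12 x; rewrite /lazy_walk !ler_wpM2r ?invr_ge0 ?ler0n //.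
by apply: ler_sum => s _; rewrite !lerD ?lerMn2r ?le12 ?orbT.
Qed.

Lemma iter_lazy_walk_le k {e} {h1 h2 : A -> R} :
  (forall x, h1 x <= h2 x) ->
  forall x, iter k (lazy_walk e) h1 x <= iter k (lazy_walk e) h2 x.
Proof. by move=> le12; elim: k => //= k IHk x; apply: lazy_walk_le. Qed.

Lemma lazy_walkD e h (a : R) x : (0 < size e)%N ->
  lazy_walk e (fun y => h y + a) x = lazy_walk e h x + a.
Proof.
move=> e0; rewrite /lazy_walk.
have E s : (h x + a) *+ 2 + (h (x + s) + a) + (h (x - s) + a) =
    (h x *+ 2 + h (x + s) + h (x - s)) + a *+ 4 by ring.
rewrite (eq_bigr _ (fun s _ => E s)) big_split /= big_const_seq count_predT iter_addr_0 !mulrDl.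
congr (_ + _).
by field; rewrite pnatr_eq0 -lt0n.
Qed.

(** Averaging commutes with adding constants, so a drift that is the same at every point just
    accumulates. This will be applied to a quadratic [h] on Z^d. *)
Lemma iter_lazy_walk_drift k e h (a : R) x : (0 < size e)%N ->
  (forall y, lazy_walk e h y = h y + a) ->
  iter k (lazy_walk e) h x = h x + a *+ k.
Proof.
move=> e0 drift; elim: k x => [|k IHk] x /=; first by rewrite addr0.
by rewrite (funext IHk) lazy_walkD // drift mulrSr addrAC addrA.
Qed.

End LazyWalk.

(** Lets a walk on [Gamma] be replaced by one on Z^d, along the additive map that sends the unit
    vectors to the generators. *)
Lemma iter_lazy_walk_comp {A B : zmodType} (D : A -> B) (e : seq A)
    (h : B -> R) k (x : A) :
  {morph D : y z / y + z} -> {morph D : y / - y} ->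
  iter k (lazy_walk e) (h \o D) x = iter k (lazy_walk (map D e)) h (D x).
Proof.
move=> DD DN; elim: k x => //= k IHk x; rewrite (funext IHk) /lazy_walk size_map big_map.
by congr (_ / _ / _); apply: eq_bigr => s _; rewrite /= !DD DN.
Qed.

(** * The lazy walk on the lattice Z^d *)

Section Lattice.
Variable d : nat.

Definition unit_steps : seq {ffun 'I_d -> int} :=
  [seq [ffun j => (i == j)%:R] | i <- enum 'I_d].

Lemma size_unit_steps : size unit_steps = d.
Proof. by rewrite size_map size_enum_ord. Qed.

(** One step moves a uniformly chosen coordinate by +1 or -1, with probability 1/4 each. The linear
    terms cancel and the square of each coordinate grows by 1 / (2 d) on average. *)
Lemma lazy_walk_sqr (w : 'I_d -> R) (a b : R) (c : {ffun 'I_d -> int}) :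
  (0 < d)%N ->
  let h := fun c : {ffun 'I_d -> int} => \sum_j w j * (a + b * (c j)%:~R ^+ 2) in
  lazy_walk unit_steps h c = h c + (\sum_j w j) * b / (2 * d%:R).
Proof.
move=> d0 h; have dn0 : d%:R != 0 :> R by rewrite pnatr_eq0 -lt0n.
rewrite /lazy_walk size_unit_steps /unit_steps big_map big_enum /=.
have E (i : 'I_d) : h c *+ 2 + h (c + [ffun j => (i == j)%:R])
     + h (c - [ffun j => (i == j)%:R]) = h c *+ 4 + w i * b *+ 2.
  have H2 : h (c + [ffun j => (i == j)%:R]) + h (c - [ffun j => (i == j)%:R]) =
      h c *+ 2 + w i * b *+ 2.
    have -> : w i * b *+ 2 = \sum_j w j * b * (i == j)%:R *+ 2.
      rewrite (bigD1 i) //= eqxx mulr1 big1 ?addr0 // => j /negbTE.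
      by rewrite eq_sym => ->; rewrite mulr0 mul0rn.
    rewrite /h -sumrMnl -!big_split /=; apply: eq_bigr => j _.
    by rewrite !ffunE !rmorphD rmorphN /=; case: (i == j); rewrite /=; ring.
  by rewrite -addrA H2; ring.
rewrite (eq_bigr _ (fun i _ => E i)) big_split /= sumr_const card_ord.
rewrite sumrMnl -mulr_suml; field; exact: dn0.
Qed.

End Lattice.

(** * Points leaving a set under translation *)

Section Crossing.
Context {Gamma : finZmodType}.
Implicit Types (Q : {set Gamma}) (x y z : Gamma).

Definition crossing Q y : nat := #|[set x in Q | x + y \notin Q]|.

Lemma card_shift (P : pred Gamma) y : #|[set x | P (x + y)]| = #|[set x | P x]|.
Proof.
rewrite -(card_imset _ (addIr (- y))); apply: eq_card => x; rewrite !inE.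
apply/idP/imsetP => [Pxy|[z]]; first by exists (x + y); rewrite ?inE ?addrK.
by rewrite inE => Pz ->; rewrite subrK.
Qed.

Lemma crossing0 Q : crossing Q 0 = 0%N.
Proof. by apply: eq_card0 => x; rewrite !inE addr0 andbN. Qed.

(** A point that leaves under [y + z] either leaves under [y], or is carried by [y] to a point of
    [Q] that leaves under [z]. Translation by [y] is a bijection, so the latter are few enough. *)
Lemma crossingD Q y z : (crossing Q (y + z)%R <= crossing Q y + crossing Q z)%N.
Proof.
rewrite [X in (_ <= _ + X)%N](_ : _ = #|[set x | (x + y \in Q) && (x + y + z \notin Q)]|); last first.
  by rewrite (card_shift (fun x => (x \in Q) && (x + z \notin Q)) y).
rewrite -cardsUI.
apply: leq_trans (leq_addr _ _); apply/subset_leq_card/subsetP => x.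
by rewrite !inE addrA; case: (x \in Q); case: (x + y \in Q).
Qed.

(** Both counts are what remains of [Q] after removing the points that stay, and translation by [y]
    matches the two sets of staying points. *)
Lemma crossingN Q y : crossing Q (- y) = crossing Q y.
Proof.
have split_card z : #|Q| = (#|[set x | (x \in Q) && ((x + z)%R \in Q)]| + crossing Q z)%N.
  rewrite /crossing -cardsUI [X in (_ = _ + X)%N]eq_card0 => [|x]; last first.
    by rewrite !inE; case: (x \in Q); case: ((x + z)%R \in Q).
  by rewrite addn0; apply: eq_card => x; rewrite !inE; case: (x \in Q); case: ((x + z)%R \in Q).
apply/(@addnI #|[set x | (x \in Q) && (x + y \in Q)]|).
rewrite -split_card (split_card (- y)); congr (_ + _)%N.
rewrite -(card_shift (fun x => (x \in Q) && (x - y \in Q)) y).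
by apply: eq_card => x; rewrite !inE addrK andbC.
Qed.

Lemma crossingMz Q y (m : int) : (crossing Q (y *~ m)%R <= `|m| * crossing Q y)%N.
Proof.
have nat_case k : (crossing Q (y *+ k)%R <= k * crossing Q y)%N.
  elim: k => [|k IHk]; first by rewrite mulr0n crossing0.
  by rewrite mulrS mulSn (leq_trans (crossingD _ _ _)) // leq_add2l.
case: m => k; first exact: nat_case.
by rewrite NegzE mulrNz crossingN abszN; apply: nat_case.
Qed.

Lemma crossing_sum Q (I : finType) (F : I -> Gamma) :
  (crossing Q (\sum_i F i)%R <= \sum_i crossing Q (F i))%N.
Proof.
apply: (big_ind2 (fun y m => crossing Q y <= m)%N) => //; first by rewrite crossing0.
by move=> y m z p ym zp; apply: leq_trans (crossingD _ _ _) (leq_add ym zp).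
Qed.

Lemma bdry_crossing (S : seq Gamma) Q : bdry S Q = (\sum_(s <- S) crossing Q s)%N.
Proof.
rewrite /bdry; under eq_bigr => x _ do rewrite -sum1_count big_mkcond.
rewrite exchange_big /=; apply: eq_bigr => s _.
by rewrite -big_mkcondr sum1dep_card; apply: eq_card => x; rewrite !inE.
Qed.

Lemma bdry_le (S : seq Gamma) Q : (bdry S Q <= deg S * #|Q|)%N.
Proof.
rewrite /bdry mulnC -sum_nat_const; apply: leq_sum => x _; exact: count_size.
Qed.

Lemma sum_shift (V : nmodType) (u : Gamma -> V) y : \sum_x u (x + y) = \sum_x u x.
Proof. by rewrite [RHS](reindex_inj (addIr y)). Qed.

Lemma autocorrelation_indic Q y :
  \sum_x indic Q x * (indic Q x - indic Q (x + y)) = (crossing Q y)%:R.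
Proof.
rewrite /crossing -sum1_card natr_sum [RHS]big_mkcond /=; apply: eq_bigr => x _.
by rewrite !inE /indic; case: (x \in Q); case: (x + y \in Q); rewrite /=; ring.
Qed.

(** Centering only adds terms that cancel in the sum over the group. The count is thus a quadratic
    form in [f], ready for expansion in eigenvectors. *)
Lemma autocorrelation_center Q y :
  let f := center (indic Q) in
  \sum_x f x * (f x - f (x + y)) = (crossing Q y)%:R.
Proof.
move=> f; rewrite -autocorrelation_indic /f /center; set a := _ / _.
have E x : (indic Q x - a) * (indic Q x - a - (indic Q (x + y) - a)) =
    indic Q x * (indic Q x - indic Q (x + y)) + (a * indic Q (x + y) - a * indic Q x).
  by ring.
rewrite (eq_bigr _ (fun x _ => E x)) big_split sumrB /=.
by rewrite (sum_shift (fun x => a * indic Q x)) subrr addr0.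
Qed.

Lemma sum_indic Q : \sum_x indic Q x = #|Q|%:R.
Proof.
by rewrite -sum1_card natr_sum [RHS]big_mkcond /=; apply: eq_bigr => x _; rewrite /indic; case: ifP.
Qed.

Lemma dotv_center_indic Q : (0 < ngr Gamma)%N ->
  let f := center (indic Q) in
  dotv f f = #|Q|%:R * (ngr Gamma - #|Q|)%:R / (ngr Gamma)%:R.
Proof.
move=> n0 f; have n0' : (ngr Gamma)%:R != 0 :> R by rewrite pnatr_eq0 -lt0n.
have mean : dotv (indic Q) (fun=> 1) = #|Q|%:R.
  by rewrite -sum_indic; apply: eq_bigr => x _; rewrite mulr1.
rewrite natrB ?max_card // /f /center mean /dotv; set a := #|Q|%:R / _.
have E x : (indic Q x - a) * (indic Q x - a) = (1 - a *+ 2) * indic Q x + a ^+ 2.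
  by rewrite /indic; case: (x \in Q) => /=; ring.
rewrite (eq_bigr _ (fun x _ => E x)).
rewrite big_split /= -mulr_sumr sum_indic sumr_const -/(ngr _).
by rewrite -mulr_natr /a; field.
Qed.

End Crossing.

(** * Expansion in an orthonormal basis *)

Section Eigen.
Context {Gamma : finZmodType}.
Variables (v : 'I_(ngr Gamma) -> Gamma -> R).
Hypothesis vB : orthonormal_basis v.
Implicit Types (x y : Gamma) (f : Gamma -> R).

(** For a square matrix, V V^T = 1 gives V^T V = 1: this is where having as many vectors as group
    elements yields completeness. *)
Lemma basis_dual x y : \sum_i v i x * v i y = (x == y)%:R.
Proof.
pose V := \matrix_(i < ngr Gamma, j < ngr Gamma) v i (enum_val j).
have VV : V *m V^T = 1%:M.
  apply/matrixP => i j; rewrite !mxE -vB /dotv [RHS](reindex _ (onW_bij _ (@enum_val_bij Gamma)))/=.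
  by apply: eq_bigr => k _; rewrite !mxE.
have := congr1 (fun M : 'M_(ngr Gamma) => M (enum_rank x) (enum_rank y)) (mulmx1C VV).
rewrite !mxE (inj_eq enum_rank_inj) => <-; apply: eq_bigr => k _.
by rewrite !mxE !enum_rankK.
Qed.

Lemma basis_expand f x : f x = \sum_i dotv f (v i) * v i x.
Proof.
under eq_bigr do rewrite /dotv mulr_suml.
rewrite exchange_big /= (bigD1 x) //= [X in _ + X]big1 => [|y neq_yx].
  under eq_bigr do rewrite -mulrA.
  by rewrite -mulr_sumr basis_dual eqxx mulr1 addr0.
under eq_bigr do rewrite -mulrA.
by rewrite -mulr_sumr basis_dual (negbTE neq_yx) mulr0.
Qed.

Lemma dotv_suml f (a : 'I_(ngr Gamma) -> R) (P : pred 'I_(ngr Gamma)) :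
  dotv f (fun x => \sum_(i | P i) a i * v i x) = \sum_(i | P i) a i * dotv f (v i).
Proof.
rewrite /dotv; under eq_bigr do rewrite mulr_sumr.
rewrite exchange_big /=; apply: eq_bigr => i _; rewrite mulr_sumr.
by apply: eq_bigr => x _; rewrite mulrCA.
Qed.

Lemma dotvC f g : dotv f g = dotv g f.
Proof. by apply: eq_bigr => x _; rewrite mulrC. Qed.

Lemma parseval f : dotv f f = \sum_i dotv f (v i) ^+ 2.
Proof.
rewrite [X in dotv _ X](funext (basis_expand f)) dotv_suml.
by apply: eq_bigr => i _.
Qed.

Lemma normv_sqr f : normv f ^+ 2 = dotv f f.
Proof. by rewrite sqr_sqrtr // sumr_ge0 // => x _; rewrite -expr2 sqr_ge0. Qed.

Lemma normv_projW k f : normv (projW v k f) ^+ 2 = \sum_(i : 'I_(ngr Gamma) | (i < k)%N) dotv f (v i) ^+ 2.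
Proof.
rewrite normv_sqr [in X in dotv _ X]/projW dotv_suml; apply: eq_bigr => i ik.
rewrite [X in _ * X]dotvC /projW dotv_suml (bigD1 i) //= vB eqxx mulr1 big1 ?addr0 // => j /andP[_].
by rewrite vB eq_sym => /negbTE->; rewrite mulr0.
Qed.

End Eigen.

(** * The lazy walk on the Cayley graph *)

Section CayleyWalk.
Context {Gamma : finZmodType} {S : seq Gamma}.
Hypothesis S_gt0 : (0 < deg S)%N.
Implicit Types (x y : Gamma) (f : Gamma -> R) (Q : {set Gamma}).

Let d_neq0 : (size S)%:R != 0 :> R.
Proof. by rewrite pnatr_eq0 -lt0n. Qed.

(** The walk is linear, fixes constants and commutes with translation by [x], so it acts on the last
    [f] alone. At [y = 0] the right side is <f, (I - W^k) f>. *)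
Lemma iter_lazy_walk_autocorrelation f k y :
  iter k (lazy_walk S) (fun z => \sum_x f x * (f x - f (x + z))) y =
  \sum_x f x * (f x - iter k (lazy_walk S) f (x + y)).
Proof.
elim: k y => //= k IHk y; rewrite (funext IHk) /lazy_walk.
set u := iter k _ f.
have E s : (\sum_x f x * (f x - u (x + y))) *+ 2 + \sum_x f x * (f x - u (x + (y + s)))
     + \sum_x f x * (f x - u (x + (y - s)))
   = \sum_x (f x * f x *+ 4 - f x * (u (x + y) *+ 2 + u (x + y + s) + u (x + y - s))).
  rewrite -sumrMnl -!big_split /=; apply: eq_bigr => x _.
  by rewrite !addrA; ring.
rewrite (eq_bigr _ (fun s _ => E s)) exchange_big /= !mulr_suml.
apply: eq_bigr => x _.
rewrite sumrB big_const_seq count_predT iter_addr_0 -mulr_sumr.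
by field.
Qed.

(** Lifted to Z^d, the count is dominated by a quadratic function of the position, whose mean after
    [k] steps is exact. The best [a] is of order sqrt (k / d). *)
Lemma crossing_walk_le Q k (a : R) : 0 < a ->
  iter k (lazy_walk S) (fun y => (crossing Q y)%:R) 0 <=
  (bdry S Q)%:R * (a + k%:R / (2 * (deg S)%:R * a)) / 2.
Proof.
move=> a0; pose D (c : {ffun 'I_(size S) -> int}) := \sum_j tnth (in_tuple S) j *~ c j.
have DD : {morph D : y z / y + z}.
  move=> y z; rewrite /D -big_split; apply: eq_bigr => j _.
  by rewrite ffunE mulrzDr.
have DN : {morph D : y / - y}.
  move=> y; rewrite /D -sumrN; apply: eq_bigr => j _.
  by rewrite ffunE mulrNz.
have Dsteps : map D (unit_steps (size S)) = S.
  rewrite -map_comp -[RHS]/(val (in_tuple S)) -[RHS]map_tnth_enum.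
  apply: eq_map => i /=; rewrite /D (bigD1 i) //= ffunE eqxx big1 ?addr0 // => j.
  by rewrite ffunE eq_sym => /negbTE->.
have D0 : D 0 = 0 by apply: big1 => j _; rewrite ffunE.
rewrite -[X in iter _ (lazy_walk X)]Dsteps -[X in iter _ _ _ X]D0.
rewrite -iter_lazy_walk_comp //.
pose w j : R := (crossing Q (tnth (in_tuple S) j))%:R.
have sum_w : \sum_j w j = (bdry S Q)%:R.
  by rewrite bdry_crossing big_tnth natr_sum.
pose h (c : {ffun 'I_(size S) -> int}) := \sum_j w j * (a / 2 + (2 * a)^-1 * (c j)%:~R ^+ 2).
(* AM-GM: [2 |m| <= a + m^2 / a] *)
have le_h c : ((fun y => (crossing Q y)%:R) \o D) c <= h c.
  rewrite /=; apply: (@le_trans _ _ (\sum_j w j * `|c j|%N%:R)).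
    rewrite /w; under eq_bigr do rewrite -natrM.
    rewrite -natr_sum ler_nat; apply: leq_trans (crossing_sum _ _) _.
    by apply: leq_sum => j _; rewrite mulnC crossingMz.
  apply: ler_sum => j _; rewrite ler_wpM2l ?ler0n //.
  rewrite natr_absz intr_norm -[X in _ + _ * X]real_normK ?num_real // -subr_ge0.
  set m := `|_|; rewrite (_ : _ - m = (m - a) ^+ 2 / (2 * a)); last by field; rewrite gt_eqF.
  by rewrite divr_ge0 ?sqr_ge0 // mulr_ge0 // ltW.
apply: le_trans (iter_lazy_walk_le k le_h 0) _.
rewrite (iter_lazy_walk_drift k (a := (bdry S Q)%:R * (2 * a)^-1 / (2 * (size S)%:R))) ?size_unit_steps //; last first.
  by move=> c; rewrite /h lazy_walk_sqr // sum_w.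
rewrite /h (eq_bigr (fun j => w j * (a / 2))) => [|j _]; last first.
  by rewrite ffunE expr0n mulr0 addr0.
rewrite -mulr_suml sum_w -mulr_natr /deg le_eqVlt; apply/orP; left; apply/eqP.
by field; rewrite d_neq0 gt_eqF.
Qed.

Hypothesis S_sym : symmetric_mset S.

Lemma sum_symmetric (u : Gamma -> R) : \sum_(s <- S) u (- s) = \sum_(s <- S) u s.
Proof.
rewrite -(big_map (fun s => - s) xpredT u); apply: perm_big.
apply/allP => x _ /=; apply/eqP; rewrite count_map [RHS]S_sym; apply: eq_count => y /=.
by rewrite eqr_oppLR.
Qed.

(** Symmetry of [S] merges the forward and backward steps, each of total weight 1/4, into half of
    the normalized adjacency operator. *)
Lemma lazy_walk_nlap u x : lazy_walk S u x = u x - nlap S u x / 2.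
Proof.
rewrite /lazy_walk /nlap /deg !big_split /= (sum_symmetric (fun s => u (x + s))).
rewrite big_const_seq count_predT iter_addr_0.
by field.
Qed.

Context {lam : 'I_(ngr Gamma) -> R} {v : 'I_(ngr Gamma) -> Gamma -> R}.
Hypotheses (vB : orthonormal_basis v) (vE : eigen_pairs S lam v).

(** Maximum principle: where [v i] is largest in absolute value, its average over the neighbours is
    no larger, so [1 - lam i] has absolute value at most 1. *)
Lemma eigenvalue_bounds i : 0 <= lam i <= 2.
Proof.
pose x := [arg max_(x > 0) `|v i x|]%O.
have xmax y : `|v i y| <= `|v i x|.
  by rewrite /x; case: arg_maxP => // z _; apply.
have vx_gt0 : 0 < `|v i x|.
  rewrite lt_neqAle normr_ge0 andbT; apply: contraPneq (vB i i) => vx0.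
  rewrite eqxx /dotv big1 => [/esym/eqP|y _]; first by rewrite oner_eq0.
  suff -> : v i y = 0 by rewrite mulr0.
  by apply/eqP; rewrite -normr_le0 vx0.
have avg : (1 - lam i) * v i x = (size S)%:R^-1 * \sum_(s <- S) v i (x + s).
  by rewrite mulrBl mul1r -vE /nlap; ring.
have : `|1 - lam i| * `|v i x| <= 1 * `|v i x|.
  rewrite -normrM avg normrM normfV normr_nat mul1r ler_pdivrMl ?ltr0n //.
  apply: le_trans (ler_norm_sum _ _ _) _.
  apply: (@le_trans _ _ (\sum_(s <- S) `|v i x|)); first by apply: ler_sum.
  by rewrite big_const_seq count_predT iter_addr_0 mulr_natl.
rewrite ler_pM2r // ler_norml => /andP[]; lra.
Qed.

Lemma iter_lazy_walk_eigen f k x :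
  iter k (lazy_walk S) f x = \sum_i dotv f (v i) * (1 - lam i / 2) ^+ k * v i x.
Proof.
elim: k x => [|k IHk] x.
  by rewrite [LHS](basis_expand vB); under [RHS]eq_bigr do rewrite expr0 mulr1.
rewrite iterS (funext IHk) lazy_walk_nlap /nlap.
have -> : \sum_(s <- S) \sum_i dotv f (v i) * (1 - lam i / 2) ^+ k * v i (x + s) =
   \sum_i dotv f (v i) * (1 - lam i / 2) ^+ k * \sum_(s <- S) v i (x + s).
  by rewrite exchange_big; apply: eq_bigr => i _; rewrite mulr_sumr.
rewrite mulr_sumr -sumrB mulr_suml -sumrB; apply: eq_bigr => i _.
have avg : (deg S)%:R^-1 * \sum_(s <- S) v i (x + s) = v i x - lam i * v i x.
  by rewrite -vE /nlap; ring.
by rewrite mulrCA avg exprS; field.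
Qed.
Lemma crossing_walk_spectral Q k :
  let f := center (indic Q) in
  iter k (lazy_walk S) (fun y => (crossing Q y)%:R) 0 =
  \sum_i dotv f (v i) ^+ 2 * (1 - (1 - lam i / 2) ^+ k).
Proof.
move=> f; rewrite -(funext (autocorrelation_center Q)) -/f.
rewrite iter_lazy_walk_autocorrelation.
under eq_bigr do rewrite addr0 mulrBr.
rewrite sumrB -/(dotv f f) -/(dotv f (iter k _ f)).
rewrite (funext (iter_lazy_walk_eigen f k)) dotv_suml (parseval vB) -sumrB.
by apply: eq_bigr => i _; ring.
Qed.

(** By induction, as (1 + (k+1) t)(1 - t) <= 1 + k t. It makes (1 - t)^k at most 1/2 as soon as k t
    >= 1. *)
Lemma bernoulli_inv (t : R) k : 0 <= t <= 1 -> (1 + k%:R * t) * (1 - t) ^+ k <= 1.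
Proof.
move=> /andP[t0 t1]; elim: k => [|k IHk]; first by rewrite mul0r addr0 mulr1.
apply: le_trans IHk; rewrite exprS mulrA ler_wpM2r ?exprn_ge0 ?subr_ge0 //.
rewrite -natr1 -subr_ge0 (_ : _ - _ = (k%:R + 1) * t ^+ 2); last by ring.
by rewrite mulr_ge0 ?sqr_ge0 // addr_ge0.
Qed.

(** For an eigenvalue above [tau] one has k * lam / 2 >= 1, so [W^k] keeps at most half of that
    component. The other terms are nonnegative because [W] has its spectrum in [0, 1]. *)
Lemma spectral_tail_le Q k (tau : R) :
  let f := center (indic Q) in
  2 <= k%:R * tau ->
  \sum_(i | tau < lam i) dotv f (v i) ^+ 2 <=
  2 * iter k (lazy_walk S) (fun y => (crossing Q y)%:R) 0.
Proof.
move=> f ktau; rewrite crossing_walk_spectral -/f mulr_sumr big_mkcond /=.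
apply: ler_sum => i _; have /andP[l0 l2] := eigenvalue_bounds i.
have t01 : 0 <= lam i / 2 <= 1 by apply/andP; split; lra.
have mu0 : 0 <= (1 - lam i / 2) ^+ k by apply: exprn_ge0; lra.
have f0 : 0 <= dotv f (v i) ^+ 2 by apply: sqr_ge0.
case: ifP => [tau_lt|_]; last first.
  rewrite mulr_ge0 // mulr_ge0 // subr_ge0 exprn_ile1 //; lra.
rewrite mulrCA ler_peMr // mulrBr mulr1.
suff : 2 * (1 - lam i / 2) ^+ k <= 1 by lra.
apply: le_trans (bernoulli_inv k t01); rewrite ler_wpM2r //.
have : k%:R * tau <= k%:R * lam i by rewrite ler_wpM2l ?ler0n // ltW.
lra.
Qed.

(** Covers conductance 0, where the threshold is 0 and no [k] satisfies 2 <= k * tau. One step of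
    the walk already gives a sum of nonnegative terms that is at most 0. *)
Lemma spectral_tail_eq0 Q :
  let f := center (indic Q) in
  bdry S Q = 0%N -> \sum_(i | 0 < lam i) dotv f (v i) ^+ 2 = 0.
Proof.
move=> f bQ0; have := crossing_walk_le Q 1 (@ltr01 R).
rewrite crossing_walk_spectral -/f bQ0 mul0r mul0r => le0.
have terms_ge0 i : true -> 0 <= dotv f (v i) ^+ 2 * (1 - (1 - lam i / 2) ^+ 1).
  move=> _; have /andP[l0 _] := eigenvalue_bounds i.
  rewrite mulr_ge0 ?sqr_ge0 // expr1; lra.
have /eqP := le_anti (introT andP (conj le0 (sumr_ge0 _ terms_ge0))).
rewrite psumr_eq0 // => /allP all0; apply: big1 => i li.
have /= := all0 i (mem_index_enum i); rewrite expr1 mulf_eq0 => /orP[/eqP //|/eqP].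
lra.
Qed.

End CayleyWalk.

(** * Sparsest cuts and conductance *)

Section Cuts.
Context {Gamma : finZmodType} {S : seq Gamma}.
Hypotheses (n_gt1 : (1 < ngr Gamma)%N) (S_gt0 : (0 < deg S)%N).
Implicit Types Q : {set Gamma}.

Lemma cond_le1 Q : cond S Q <= 1.
Proof.
rewrite /cond; have [->|Q0] := posnP #|Q|; first by rewrite mulr0 invr0 mulr0.
by rewrite ler_pdivrMr ?mulr_gt0 ?ltr0n // mul1r -natrM ler_nat bdry_le.
Qed.

Lemma conductance_attained :
  exists Q, [/\ (0 < #|Q|)%N, (#|Q|.*2 <= ngr Gamma)%N & cond S Q <= conductance S].
Proof.
rewrite /conductance; elim/big_ind: _ => [|x y [Q1 [? ? leQ1]] [Q2 [? ? leQ2]]|Q /andP[? ?]].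
(* The starting value 1 of the fold is dominated by a singleton, which is admissible since the group
   has at least two elements. *)
- by exists [set 0]; rewrite cards1 cond_le1.
- have [_|_] := leP x y; [by exists Q1 | by exists Q2].
- by exists Q.
Qed.

Lemma conductance_ge0 : 0 <= conductance S.
Proof.
have [Q [_ _]] := conductance_attained; apply: le_trans.
by rewrite divr_ge0 ?mulr_ge0.
Qed.

Lemma proper_cutE Q : proper_cut Q = (0 < #|Q| < ngr Gamma)%N.
Proof.
by rewrite /proper_cut card_gt0 /ngr -cardsT -properT properEcard subsetT.
Qed.

Lemma sparsest_cut_exists : exists Q, sparsest_cut S Q.
Proof.
have cut0 : proper_cut [set 0 : Gamma] by rewrite proper_cutE cards1.
have [Q cutQ Qmin] := @Order.TotalTheory.arg_minP _ _ _ [set 0] (@proper_cut Gamma) (spars S) cut0.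
by exists Q; rewrite /sparsest_cut cutQ; apply/fintype.forallP => Q'; apply/implyP => /Qmin.
Qed.

(** Compare [Q] with a set [Q'] realizing the conductance: since n - |Q'| >= n / 2, its sparsity is
    at most 2 d phi / n, while |f|^2 = |Q| (n - |Q|) / n. *)
Lemma sparsest_bdry_le Q : sparsest_cut S Q ->
  (bdry S Q)%:R <=
  2 * (deg S)%:R * conductance S * dotv (center (indic Q)) (center (indic Q)).
Proof.
case/andP=> cutQ /fintype.forallP Qmin; have [Q' [Q'0 Q'n condQ']] := conductance_attained.
have Q'lt : (#|Q'| < ngr Gamma)%N.
  by apply: leq_trans Q'n; rewrite -addnn -{1}[#|Q'|]addn0 ltn_add2l.
have cutQ' : proper_cut Q' by rewrite proper_cutE Q'0.
have := implyP (Qmin Q') cutQ'; rewrite /spars.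
have /andP[Q0 Qn] : (0 < #|Q| < ngr Gamma)%N by rewrite -proper_cutE.
have q0 : 0 < (#|Q|%:R * (ngr Gamma - #|Q|)%:R : R) by rewrite mulr_gt0 ?ltr0n ?subn_gt0.
have n0 : 0 < (ngr Gamma)%:R :> R by rewrite ltr0n; lia.
rewrite ler_pdivrMr // => /le_trans; apply.
rewrite dotv_center_indic; last by lia.
rewrite [leRHS]mulrA [leRHS]mulrAC ler_pM2r // ler_pdivlMr //.
have bQ' : (bdry S Q')%:R <= conductance S * ((deg S)%:R * #|Q'|%:R).
  by rewrite -ler_pdivrMr ?mulr_gt0 ?ltr0n.
have Q'0' : 0 < #|Q'|%:R :> R by rewrite ltr0n.
have half : (ngr Gamma)%:R <= 2 * (ngr Gamma - #|Q'|)%:R :> R.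
  by rewrite -natrM ler_nat; move: Q'n; rewrite -mul2n; set m := #|_|; set n := ngr _; lia.
have c0 : 0 < (ngr Gamma - #|Q'|)%:R :> R by lra.
rewrite mulrAC ler_pdivrMr ?mulr_gt0 //.
have dphi : 0 <= (deg S)%:R * conductance S by rewrite mulr_ge0 ?conductance_ge0.
apply: le_trans (ler_wpM2r (ltW n0) bQ') _.
have := ler_wpM2l (mulr_ge0 dphi (ltW Q'0')) half.
by rewrite -subr_ge0 => ?; rewrite -subr_ge0; nra.
Qed.

End Cuts.

(** If [i] is in [A], so are the i + 1 indices up to it; otherwise [A] lies among the i indices
    below it. *)
Lemma down_closed_card n (A : {set 'I_n}) (i : 'I_n) :
  (forall j k : 'I_n, (j <= k)%N -> k \in A -> j \in A) -> (i < #|A|)%N = (i \in A).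
Proof.
have card_widen m (le_mn : (m <= n)%N) : #|[set widen_ord le_mn j | j : 'I_m]| = m.
  by rewrite card_imset ?card_ord // => j k /(congr1 val) /= /val_inj.
move=> downA; case: (boolP (i \in A)) => [iA|iNA]; apply/idP.
  rewrite -[X in (X <= _)%N](card_widen _ (ltn_ord i)); apply/subset_leq_card/subsetP.
  by move=> _ /imsetP[j _ ->]; apply: downA iA; rewrite /= -ltnS.
apply/negP; rewrite -leqNgt -[X in (_ <= X)%N](card_widen _ (ltnW (ltn_ord i))).
apply/subset_leq_card/subsetP => j jA; apply/imsetP.
have ji : (j < i)%N by rewrite ltnNge; apply: contra iNA => /downA; apply.
by exists (Ordinal ji) => //; apply: val_inj.
Qed.

Lemma CD_le (Gamma : finZmodType) (S : seq Gamma) v eps k :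
  (k <= ngr Gamma)%N -> CD_ok S v eps k -> (CD S v eps <= k)%N.
Proof.
move=> kn okk; rewrite leqNgt; apply/negP => /(before_find 0%N).
by rewrite nth_iota ?add0n ?okk // ltnS.
Qed.

(** * The spectral tail of a sparsest cut *)

Lemma in_Ceps_normalize (Gamma : finZmodType) (v : 'I_(ngr Gamma) -> Gamma -> R)
    (f : Gamma -> R) (eps : R) k :
  orthonormal_basis v -> 0 < dotv f f ->
  \sum_(i : 'I_(ngr Gamma) | ~~ (i < k)%N) dotv f (v i) ^+ 2 <= eps * dotv f f ->
  in_Ceps v eps k (normalize f).
Proof.
move=> vB f0 tail; have N0 : dotv f f != 0 by rewrite gt_eqF.
have nE g : dotv (normalize f) g = dotv f g / normv f.
  by rewrite /dotv mulr_suml; apply: eq_bigr => x _; rewrite /normalize mulrAC.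
have n1 : dotv (normalize f) (normalize f) = 1.
  by rewrite nE dotvC nE -mulrA -invfM -expr2 normv_sqr divff.
rewrite /in_Ceps {1}/normv n1 sqrtr1 eqxx normv_projW //=.
under eq_bigr do rewrite nE expr_div_n normv_sqr.
rewrite -mulr_suml ler_pdivlMr // mulrBl mul1r.
have := parseval vB f; rewrite (bigID (fun i : 'I__ => (i < k)%N)) /=. lra.
Qed.

Section Tail.
Context {Gamma : finZmodType} {S : seq Gamma}.
Context {lam : 'I_(ngr Gamma) -> R} {v : 'I_(ngr Gamma) -> Gamma -> R}.
Hypotheses (n_gt1 : (1 < ngr Gamma)%N) (S_gt0 : (0 < deg S)%N).
Hypotheses (S_sym : symmetric_mset S) (vB : orthonormal_basis v).
Hypothesis vE : eigen_pairs S lam v.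

Lemma sparsest_tail_le Q (eps : R) : 0 < eps -> sparsest_cut S Q ->
  \sum_(i | 32 * (deg S)%:R * conductance S ^+ 2 / eps ^+ 2 < lam i)
     dotv (center (indic Q)) (v i) ^+ 2
  <= eps * dotv (center (indic Q)) (center (indic Q)).
Proof.
move=> eps0 cutQ; set tau := _ / _; set f := center _.
have bQ := sparsest_bdry_le n_gt1 S_gt0 cutQ.
have f0 : 0 <= dotv f f by apply: sumr_ge0 => x _; rewrite -expr2 sqr_ge0.
have d0 : 0 < (deg S)%:R :> R by rewrite ltr0n.
have := conductance_ge0 n_gt1 S_gt0.
rewrite le_eqVlt => /orP[/eqP phi0|phi_gt0].
  have -> : tau = 0 by rewrite /tau -phi0 expr0n mulr0 mul0r.
  rewrite (spectral_tail_eq0 S_gt0 S_sym vB vE) ?mulr_ge0 ?(ltW eps0) //.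
  by move: bQ; rewrite -phi0 mulr0 mul0r lern0 => /eqP.
have tau0 : 0 < tau by rewrite divr_gt0 ?mulr_gt0 ?exprn_gt0.
(* For [tau] at least 2 the tail is empty; below 2, rounding up [2 / tau] costs at most a factor
   2. *)
have [tau2|tau2] := leP 2 tau.
  rewrite big_pred0 ?mulr_ge0 ?(ltW eps0) // => i; apply/negbTE; rewrite -leNgt.
  have /andP[_] := eigenvalue_bounds S_gt0 vB vE i.
  by move=> /le_trans; apply.
(* The least integer above [2 / tau], so that 2 <= k * tau <= 2 + tau <= 4. *)
pose k := (Num.truncn (2 / tau)).+1.
have kx0 : 0 <= 2 / tau by rewrite divr_ge0 // ltW.
have /andP[kge klt] := truncn_itv kx0.
have ktau2 : 2 <= k%:R * tau by rewrite -ler_pdivrMr // ltW.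
have ktau4 : k%:R * tau <= 4.
  apply: (@le_trans _ _ ((2 / tau + 1) * tau)); first by rewrite ler_pM2r // /k -[leLHS]natr1 lerD2r.
  by rewrite mulrDl mul1r divfK ?gt_eqF //; lra.
apply: le_trans (spectral_tail_le S_gt0 S_sym vB vE Q ktau2) _.
(* [a] minimizes [a + k / (2 d a)] up to a constant factor. *)
pose phi := conductance S; pose a := eps / (4 * (deg S)%:R * phi).
have a0 : 0 < a by rewrite divr_gt0 ?mulr_gt0.
have phi_neq0 : phi != 0 by rewrite gt_eqF.
have d_neq0 : (deg S)%:R != 0 :> R by rewrite gt_eqF.
have eps_neq0 : eps != 0 by rewrite gt_eqF.
pose p := a + k%:R / (2 * (deg S)%:R * a).
have p0 : 0 <= p.
  by rewrite /p addr_ge0 ?(ltW a0) // divr_ge0 // mulr_ge0 ?(ltW a0) // mulr_ge0.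
apply: (@le_trans _ _ ((bdry S Q)%:R * p)).
  by have := crossing_walk_le S_gt0 Q k a0; rewrite -/p; lra.
apply: le_trans (ler_wpM2r p0 bQ) _.
rewrite mulrAC ler_wpM2r // -/phi.
(* The choice of [a] makes the first summand eps / 2. The constant 32 in [tau] gives the factor eps
   / 8, so that k * tau <= 4 bounds the second by eps / 2. *)
have -> : 2 * (deg S)%:R * phi * p = eps / 2 + eps / 8 * (k%:R * tau).
  by rewrite /p /tau /a -/phi; field; rewrite phi_neq0 d_neq0 eps_neq0.
by have := ler_wpM2l (ltW eps0) ktau4; lra.
Qed.

End Tail.

Theorem theorem1p8 :
  exists C : Rdefinitions.R, 0 < C /\
  forall (Gamma : finZmodType) (S : seq Gamma) (eps : Rdefinitions.R)
         (lam : 'I_(ngr Gamma) -> Rdefinitions.R) (v : 'I_(ngr Gamma) -> Gamma -> Rdefinitions.R),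
    (1 < ngr Gamma)%N ->
    (0 < deg S)%N ->
    symmetric_mset S ->
    0 < eps <= 1 ->
    orthonormal_basis v ->
    eigen_pairs S lam v ->
    sorted_eigenvalues lam ->
    (CD S v eps <=
       mul_tau lam (C * (deg S)%:R * conductance S ^+ 2 / eps ^+ 2))%N.
Proof.
exists 32; split=> // Gamma S eps lam v n_gt1 S_gt0 S_sym /andP[eps0 _] vB vE lam_sorted.
have [Q cutQ] := sparsest_cut_exists (S := S) n_gt1.
have := sparsest_tail_le n_gt1 S_gt0 S_sym vB vE eps0 cutQ.
set tau := _ / _ => tail.
apply: CD_le; first by rewrite -[leqRHS]card_ord max_card.
apply/existsP; exists Q; rewrite cutQ /=; apply: in_Ceps_normalize => //.
  have /andP[Q0 Qn] : (0 < #|Q| < ngr Gamma)%N by rewrite -proper_cutE; case/andP: cutQ.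
  have n_gt0 := ltnW n_gt1.
  by rewrite dotv_center_indic // divr_gt0 ?mulr_gt0 ?ltr0n ?subn_gt0.
(* As the eigenvalues are sorted, those at most [tau] occupy exactly the first [mul_tau] indices, so
   the mass outside the span is the spectral tail. *)
rewrite (eq_bigl (fun i => tau < lam i)) // => i.
rewrite /mul_tau down_closed_card ?inE -?ltNge // => j k jk; rewrite !inE.
exact/le_trans/lam_sorted.
Qed.
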